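(* For every integer $n\geq 2$, \[DM(n,2)=\sum_{k=1}^{n-1}\ \sum_{\substack{n_{1}+\cdots+n_{k}=n \\ n_{i}\in \mathbb{Z}_{>0}}}\ \prod_{j=1}^k j^{\,n_j-1}.\]
   Context: A distance monoid is a structure $(R,\oplus,\leq,0)$ such that: $\leq$ is a total order on $R$; $r\leq r\oplus s$ for all $r,s$; if $r\leq t$ and $s\leq u$ then $r\oplus s\leq t\oplus u$; $\oplus$ is commutative and associative; and $r\oplus 0=r$ for all $r$. The Archimedean complexity $\mathrm{arch}(R)$ of a distance monoid $R$ is the least $m$ such that for all $r_0\leq r_1\leq\cdots\leq r_m$ in $R$ one has $r_0\oplus r_1\oplus\cdots\oplus r_m=r_1\oplus\cdots\oplus r_m$ (and $\omega$ if no such $m$ exists). $DM(n,k)$ denotes the number of distance monoids (up to isomorphism of ordered monoids) with exactly $n$ non-zero elements and Archimedean complexity $k$. *)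

(* Defs.v *)
From HB Require Import structures.
From mathcomp Require Import all_boot.
From mathcomp Require Import boolp.

Set Implicit Arguments.
Unset Strict Implicit.
Unset Printing Implicit Defensive.

Record ordAddStruct := OrdAddStruct {
  carrier :> Type;
  oadd : carrier -> carrier -> carrier;
  ole : rel carrier;
  ozero : carrier
}.

Arguments ozero : clear implicits.

Record distance_monoid (R : ordAddStruct) : Prop := DistanceMonoid {
  dm_le_refl : reflexive (@ole R);
  dm_le_anti : antisymmetric (@ole R);
  dm_le_trans : transitive (@ole R);
  dm_le_total : total (@ole R);
  dm_le_addr : forall r s : R, ole r (oadd r s);
  dm_le_add : forall r s t u : R, ole r t -> ole s u -> ole (oadd r s) (oadd t u);
  dm_addC : commutative (@oadd R);
  dm_addA : associative (@oadd R);
  dm_addr0 : right_id (ozero R) (@oadd R)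
}.

(* For m = 0 the right-hand side is the empty sum, i.e. 0. *)
Definition arch_cond (R : ordAddStruct) (m : nat) : Prop :=
  forall r : nat -> R, (forall i, i < m -> ole (r i) (r i.+1)) ->
    \big[@oadd R/ozero R]_(0 <= i < m.+1) r i =
    \big[@oadd R/ozero R]_(1 <= i < m.+1) r i.

(* None stands for omega. *)
Definition arch (R : ordAddStruct) : option nat :=
  if pselect (exists m, `[< arch_cond R m >]) is left exm
  then Some (ex_minn exm) else None.

Definition isomorphic (R S : ordAddStruct) : Prop :=
  exists phi : R -> S,
    [/\ bijective phi,
        phi (ozero R) = ozero S,
        {morph phi : r s / oadd r s >-> oadd r s} &
        {mono phi : r s / ole r s >-> ole r s}].

(* All structures on the carrier T, as a finite type: (addition, order, zero). *)
Definition structOn (T : finType) : finType :=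
  ({ffun T * T -> T} * {ffun T * T -> bool} * T)%type.

Definition structOf (T : finType) (x : structOn T) : ordAddStruct :=
  let: (add, le, zero) := x in
  @OrdAddStruct T (fun r s => add (r, s)) (fun r s => le (r, s)) zero.

(* Isomorphism classes are counted on the fixed carrier 'I_n.+1: every
   structure with n.+1 elements is isomorphic to one on 'I_n.+1. *)
Definition DM (n k : nat) : nat :=
  #|equivalence_partition
      (fun x y : structOn 'I_n.+1 => `[< isomorphic (structOf x) (structOf y) >])
      [set x : structOn 'I_n.+1 |
         `[< distance_monoid (structOf x) /\ arch (structOf x) = Some k >]]|.

(* f j is the part n_(j+1) of the composition n = n_1 + ... + n_k; each part is
   at most n, so 'I_n.+1 is large enough as a codomain. *)
Definition compositions (n k : nat) : {set {ffun 'I_k -> 'I_n.+1}} :=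
  [set f : {ffun 'I_k -> 'I_n.+1} |
     [forall j, 0 < f j] && (\sum_(j < k) f j == n)].

(* Main.v *)
Require Import Defs.
From mathcomp Require Import all_boot zify.
From mathcomp Require Import boolp.

Set Implicit Arguments.
Unset Strict Implicit.
Unset Printing Implicit Defensive.

(** In a distance monoid of complexity at most 2, the double [r + r] is the
    least idempotent above [r], and [r + s] for [r <= s] depends only on [s] and
    on the interval between consecutive idempotents containing [r]. Adding the
    idempotents below [s] gives a chain of closure operators on the interval of
    [s], so the addition is encoded by one level [a y] per element, the number of
    nonzero idempotents [e <= y] with [e + y = y]: with [rank r] the number of
    idempotents below [r], [r + s] is the least [t >= s] with [a t >= rank r].
    Every [a] with [a x <= rank x], and equality at the top, arises exactly once.
    These level functions are restricted growth sequences, counted by the Bell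
    number, which is also the sum over the compositions with up to [n] parts.
    The composition [1 + ... + 1] corresponds to the monoid [(max, <=)], the only
    one of complexity 1. Isomorphism classes are represented uniquely on the
    standard chain because finite chains are rigid. *)

(** * Weighted compositions and restricted growth sequences *)

(** The bound [N] on the parts is kept apart from the total [n], so that recursion on the total
    stays within one finite type. The shift [j] of the bases is what remains after the first [j]
    parts are removed. *)
Definition comp_sum (N k n j : nat) : nat :=
  \sum_(f : {ffun 'I_k -> 'I_N.+1} | [forall i, 0 < f i] && (\sum_(i < k) f i == n))
     \prod_(i < k) (j + i).+1 ^ (f i - 1).

Definition ffcons (T : Type) (k : nat) (p : T * {ffun 'I_k -> T}) :
    {ffun 'I_k.+1 -> T} :=
  [ffun i => if unlift ord0 i is Some i' then p.2 i' else p.1].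

Lemma ffcons0 (T : Type) k (p : T * {ffun 'I_k -> T}) : ffcons p ord0 = p.1.
Proof. by rewrite ffunE unlift_none. Qed.

Lemma ffconsS (T : Type) k (p : T * {ffun 'I_k -> T}) i :
  ffcons p (lift ord0 i) = p.2 i.
Proof. by rewrite ffunE liftK. Qed.

Lemma ffcons_bij (T : finType) k : bijective (@ffcons T k).
Proof.
exists (fun f : {ffun 'I_k.+1 -> T} => (f ord0, [ffun i => f (lift ord0 i)])).
  move=> [x g]; rewrite ffcons0; congr pair.
  by apply/ffunP=> i; rewrite ffunE ffconsS.
move=> f; apply/ffunP=> i; rewrite ffunE.
by case: unliftP => [i' ->|->] //=; rewrite ffunE.
Qed.

Lemma comp_sum0 N n j : comp_sum N 0 n j = (n == 0).
Proof.
rewrite /comp_sum (eq_bigl (fun=> n == 0)); last first.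
  move=> f; rewrite big_ord0 eq_sym; case: (n == 0); rewrite ?andbF ?andbT //.
  by apply/forallP=> -[].
case: (n == 0); last by rewrite big_pred0.
rewrite (eq_bigr (fun=> 1)) => [|f _]; last by rewrite big_ord0.
by rewrite sum1_card card_ffun !card_ord.
Qed.

(** Split off the first part [p.+1]; the bases of the other parts then shift by one. *)
Lemma comp_sum_rec N k n j : n <= N ->
  comp_sum N k.+1 n j =
  \sum_(0 <= p < n) j.+1 ^ p * comp_sum N k (n - p.+1) j.+1.
Proof.
move=> leN.
rewrite /comp_sum (reindex _ (onW_bij _ (@ffcons_bij _ k))) /=.
(* The condition [p <= n] is recorded because the subtraction [n - p] is truncated. *)
have E0 (p : 'I_N.+1) (g : {ffun 'I_k -> 'I_N.+1}) :
    ([forall i, 0 < ffcons (p, g) i] &&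
      (\sum_(i < k.+1) ffcons (p, g) i == n)) =
    (0 < p <= n) && ([forall i, 0 < g i] && (\sum_(i < k) g i == n - p)).
  rewrite big_ord_recl ffcons0 /=.
  under eq_bigr => i _ do rewrite ffconsS /=.
  have -> : [forall i, 0 < ffcons (p, g) i] = (0 < p) && [forall i, 0 < g i].
    apply/forallP/andP => [H|[p0 /forallP H] i].
      split; first by have := H ord0; rewrite ffcons0.
      by apply/forallP=> i; have := H (lift ord0 i); rewrite ffconsS.
    by case: (unliftP ord0 i) => [i' ->|->]; rewrite ?ffconsS ?ffcons0.
  case: (0 < p) => //=; case: [forall i, 0 < g i]; rewrite ?andbF //=.
  by apply/idP/idP; lia.
rewrite (eq_big (fun q : 'I_N.+1 * {ffun 'I_k -> 'I_N.+1} =>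
    (0 < q.1 <= n) && ([forall i, 0 < q.2 i] && (\sum_(i < k) q.2 i == n - q.1)))
  (fun q => j.+1 ^ (q.1 - 1) * \prod_(i < k) (j.+1 + i).+1 ^ (q.2 i - 1)));
  [|by case=> p g; rewrite E0|]; last first.
  move=> [p g] _; rewrite big_ord_recl ffcons0 addn0 /=; congr muln.
  by apply: eq_bigr => i _; rewrite ffconsS /bump /= add1n addnS.
rewrite -(pair_big_dep (fun p : 'I_N.+1 => 0 < p <= n)
  (fun (p : 'I_N.+1) (g : {ffun 'I_k -> 'I_N.+1}) =>
     [forall i, 0 < g i] && (\sum_(i < k) g i == n - p))
  (fun p g => j.+1 ^ (p - 1) * \prod_(i < k) (j.+1 + i).+1 ^ (g i - 1))) /=.
under eq_bigr => p _ do rewrite -big_distrr /=.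
rewrite -(big_mkord (fun p => 0 < p <= n) (fun p => j.+1 ^ (p - 1) *
  \sum_(g : {ffun 'I_k -> 'I_N.+1} | [forall i, 0 < g i] &&
      (\sum_(i < k) g i == n - p))
     \prod_(i < k) (j.+1 + i).+1 ^ (g i - 1))).
rewrite big_mkcond big_ltn //= add0n.
rewrite big_add1 /=.
(* First parts larger than [n] fit in the codomain but contribute nothing. *)
rewrite (big_cat_nat (n := n)) //= [X in _ + X]big_nat_cond [X in _ + X]big1 ?addn0.
  rewrite big_nat [RHS]big_nat; apply: eq_bigr => p lp.
  by rewrite subn1 /=; have -> : p < n by lia.
by move=> p lp; have -> : p < n = false by lia.
Qed.

(** Either the first part is 1 and is removed, or it is larger and is lowered by one at the cost of
    a factor [j.+1]. *)
Lemma comp_sumS N k n j : n < N ->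
  comp_sum N k.+1 n.+1 j = comp_sum N k n j.+1 + j.+1 * comp_sum N k.+1 n j.
Proof.
move=> lt; rewrite comp_sum_rec // comp_sum_rec ?(ltnW lt) //.
rewrite big_nat_recl // expn0 mul1n subn1 /=; congr addn.
rewrite big_distrr /=; apply: eq_bigr => p _.
by rewrite expnS subSS mulnA.
Qed.

Lemma comp_sum_gt N k n j : n <= N -> n < k -> comp_sum N k n j = 0.
Proof.
elim: k n j => // k IH n j leN lt; rewrite comp_sum_rec // big_nat big1 // => p lp.
by rewrite IH ?muln0 //; lia.
Qed.

Lemma comp_sum_diag N n j : n <= N -> comp_sum N n n j = 1.
Proof.
elim: n j => [|n IH] j leN; first by rewrite comp_sum0.
by rewrite comp_sumS // IH ?(ltnW leN) // comp_sum_gt ?muln0 // ltnW.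
Qed.

Lemma comp_sumE n k : \sum_(f in compositions n k) \prod_(j < k) j.+1 ^ (f j - 1)
  = comp_sum n k n 0.
Proof. by apply: eq_bigl => f; rewrite inE. Qed.

(* Restricted growth sequences of length [n]: each entry is at most the current
   bound, which starts at [b] and grows by one when it is attained. *)
Fixpoint rgs (n b : nat) : seq (seq nat) :=
  if n is n'.+1 then
    [seq c :: s | c <- iota 0 b.+1, s <- rgs n' (maxn b c.+1)]
  else [:: [::]].

Lemma rgsS n b :
  rgs n.+1 b = [seq c :: s | c <- iota 0 b.+1, s <- rgs n (maxn b c.+1)].
Proof. by []. Qed.

(** The bound in force once the entries of [s] have been read. *)
Definition rk (b : nat) (s : seq nat) := foldl (fun b c => maxn b c.+1) b s.

Lemma mem_rgs n b s : reflect
  (size s = n /\ forall i, i < n -> nth 0 s i <= rk b (take i s))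
  (s \in rgs n b).
Proof.
apply: (iffP idP).
  elim: n b s => [|n IH] b s; first by rewrite inE => /eqP->.
  rewrite rgsS => /allpairsPdep[c [t [cb /IH[st ht] ->]]].
  rewrite /= st; split=> // -[|i] /= lti; last exact: ht.
  by move: cb; rewrite mem_iota.
elim: n b s => [|n IH] b [|c s] [] // [sz] H.
rewrite rgsS; apply/allpairsPdep; exists c, s.
split=> //; first by rewrite mem_iota add0n ltnS; exact: (H 0).
by apply: IH; split=> // i lti; exact: (H i.+1).
Qed.

Lemma rgs_uniq n b : uniq (rgs n b).
Proof.
elim: n b => // n IH b; rewrite rgsS.
apply: allpairs_uniq_dep; [exact: iota_uniq|by move=> *; exact: IH|].
by move=> [c s] [d t] _ _ /= [-> ->].
Qed.

(** The [b] first entries below [b] keep the bound; the entry [b] raises it. *)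
Lemma size_rgsS n b :
  size (rgs n.+1 b) = b * size (rgs n b) + size (rgs n b.+1).
Proof.
rewrite rgsS size_allpairs_dep -addn1 iotaD map_cat sumn_cat.
rewrite /= addn0 add0n; congr (_ + size (rgs n _)); last by lia.
rewrite sumnE big_map big_seq (eq_bigr (fun=> size (rgs n b))) => [|x].
  by rewrite -big_seq big_const_seq count_predT size_iota iter_addn_0 mulnC.
by rewrite mem_iota => h; congr (size (rgs n _)); lia.
Qed.

(** Summed over [k], the recursion [comp_sumS] becomes that of [size_rgsS] at bound [j.+1]. *)
Lemma sum_comp_sum N n j : n < N ->
  \sum_(0 <= k < n.+2) comp_sum N k n.+1 j = size (rgs n j.+1).
Proof.
elim: n j => [|n IH] j lt.
  by rewrite !big_nat_recr //= big_geq // comp_sum0 comp_sum_diag.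
rewrite big_nat_recl // comp_sum0 add0n.
under eq_bigr => k _ do rewrite comp_sumS //.
rewrite big_split /= IH ?(ltnW lt) // -big_distrr /= size_rgsS addnC; congr (_ * _ + _).
(* The index shift is free: no composition of [n.+1] has 0 parts or [n.+2] parts. *)
rewrite -IH ?(ltnW lt) // [RHS]big_nat_recl // comp_sum0 add0n.
by rewrite big_nat_recr //= [X in _ + X]comp_sum_gt ?addn0 // ltnW.
Qed.

(** The successor accounts for the omitted term [k = n], whose only composition is 1 + ... + 1. On
    the right, bound 0 forces the first entry to be 0 and leaves bound 1. *)
Lemma sum_compositions n : 0 < n ->
  (\sum_(1 <= k < n) \sum_(f in compositions n k)
     \prod_(j < k) j.+1 ^ (f j - 1)).+1 = size (rgs n 0).
Proof.
case: n => // n _; rewrite size_rgsS add0n -(sum_comp_sum _ (leqnn _)).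
rewrite [RHS]big_nat_recr //= comp_sum_diag // addn1.
by rewrite [in RHS]big_ltn // comp_sum0; congr _.+1; apply: eq_bigr => k _; exact: comp_sumE.
Qed.

(** * Addition defined by levels *)

(** One more than the largest level strictly below [x], or 0 at [x = 0]. For the levels of a monoid
    this counts the idempotents below [x] ([rank_op_level]). *)
Fixpoint rank (a : nat -> nat) (x : nat) : nat :=
  if x is y.+1 then maxn (rank a y) (a y).+1 else 0.

Lemma rank_mono a x y : x <= y -> rank a x <= rank a y.
Proof.
elim: y => [|y IH]; first by case: x.
rewrite leq_eqVlt => /predU1P[->//|/IH]; rewrite /=; lia.
Qed.

Lemma eq_rank a a' x : (forall y, y < x -> a y = a' y) -> rank a x = rank a' x.
Proof.
elim: x => //= x IH E; rewrite IH ?E // => y lt; apply: E; lia.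
Qed.

Section LevelAddition.

Variables (n : nat) (a : nat -> nat).

(** Since [a y <= rank a y], each step raises the rank by at most one, so no value is skipped. *)
Lemma rank_surj x j : (forall y, y <= n -> a y <= rank a y) -> x <= n ->
  j <= rank a x -> exists2 r, r <= x & rank a r = j.
Proof.
move=> a_le; elim: x => [|x IH] lex.
  by rewrite leqn0 => /eqP->; exists 0.
case: (leqP j (rank a x)) => [/IH|gt le].
  by case=> [|r ler <-]; [exact: ltnW | exists r; lia].
by exists x.+1 => //; move: gt le (a_le _ (ltnW lex)) => /=; lia.
Qed.

(** The least [t >= x] with [j <= a t], searched up to [n]; the search succeeds when [x <= n] and
    [j <= a n]. *)
Definition lnext (x j : nat) : nat :=
  x + find (fun t => j <= a t) (iota x (n.+1 - x)).

Lemma lnext_spec x j : x <= n -> j <= a n ->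
  [/\ x <= lnext x j, lnext x j <= n, j <= a (lnext x j)
    & forall y, x <= y < lnext x j -> a y < j].
Proof.
move=> lex lej; rewrite /lnext.
set p := fun t => j <= a t; set s := iota x _.
have hs : has p s by apply/hasP; exists n => //; rewrite mem_iota; lia.
have lf : find p s < n.+1 - x by rewrite -[X in _ < X](size_iota x) -has_find.
split; [lia|lia| |].
  by have := nth_find 0 hs; rewrite nth_iota.
move=> y /andP[xy yx]; have := @before_find _ 0 p s (y - x).
rewrite nth_iota; last by lia.
by rewrite subnKC // => H; rewrite ltnNge; apply/negbT; apply: H; lia.
Qed.

Lemma lnext_eq x j u : x <= u -> u <= n -> j <= a u -> j <= a n ->
  (forall y, x <= y < u -> a y < j) -> lnext x j = u.
Proof.
move=> xu un ju jn lt.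
have [h1 h2 h3 h4] := lnext_spec (leq_trans xu un) jn.
case: (ltngtP (lnext x j) u) => // h.
  by have := lt (lnext x j); lia.
by have := h4 u; lia.
Qed.

Lemma lnext_id x j : x <= n -> j <= a n -> (lnext x j == x) = (j <= a x).
Proof.
move=> xn jn; apply/eqP/idP => [<-|h]; first by case: (lnext_spec xn jn).
by apply: lnext_eq => // y; lia.
Qed.

Lemma lnext_le x x' j j' : x <= x' -> x' <= n -> j <= j' -> j' <= a n ->
  lnext x j <= lnext x' j'.
Proof.
move=> xx xn jj jn.
have [h1 h2 h3 h4] := lnext_spec (leq_trans xx xn) (leq_trans jj jn).
have [k1 k2 k3 k4] := lnext_spec xn jn.
case: leqP => // h; have := h4 (lnext x' j'); lia.
Qed.

(** For fixed [j], [lnext] is a closure operator whose closed points are those of level at least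
    [j]. These sets shrink as [j] grows, so a composite of two such operators is the one with the
    larger index. *)
Lemma lnext_next_ge x j k : x <= n -> j <= a n -> k <= j ->
  lnext (lnext x j) k = lnext x j.
Proof.
move=> xn jn kj; have [h1 h2 h3 h4] := lnext_spec xn jn.
by apply/eqP; rewrite lnext_id //; lia.
Qed.

Lemma lnext_next_le x j k : x <= n -> j <= k -> k <= a n ->
  lnext (lnext x j) k = lnext x k.
Proof.
move=> xn jk kn; have [k1 k2 k3 k4] := lnext_spec xn kn.
have [h1 h2 h3 h4] := lnext_spec xn (leq_trans jk kn).
apply: lnext_eq => // [|y hy]; first exact: lnext_le.
by apply: k4; lia.
Qed.

Lemma lnext_gap x j y : x <= n -> j <= a n -> x <= y <= lnext x j ->
  lnext y j = lnext x j.
Proof.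
move=> xn jn hy; have [h1 h2 h3 h4] := lnext_spec xn jn.
apply: lnext_eq => // [|z hz]; first by lia.
by apply: h4; lia.
Qed.

Definition ladd (r s : nat) : nat := lnext (maxn r s) (rank a (minn r s)).

Lemma laddC r s : ladd r s = ladd s r.
Proof. by rewrite /ladd maxnC minnC. Qed.

Lemma laddE r s : r <= s -> ladd r s = lnext s (rank a r).
Proof. by move=> rs; rewrite /ladd (maxn_idPr rs) (minn_idPl rs). Qed.

Hypothesis a_top : a n = rank a n.

Lemma rank_le_top x : x <= n -> rank a x <= a n.
Proof. by rewrite a_top; exact: rank_mono. Qed.

Lemma ladd_bound r s : r <= n -> s <= n -> ladd r s <= n.
Proof.
by move=> rn sn; case: (@lnext_spec (maxn r s) (rank a (minn r s))) => //;
  [lia | apply: rank_le_top; lia].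
Qed.

Lemma leq_laddr r s : r <= n -> s <= n -> r <= ladd r s.
Proof.
move=> rn sn; case: (@lnext_spec (maxn r s) (rank a (minn r s))) => //;
  [lia | apply: rank_le_top; lia | rewrite /ladd; lia].
Qed.

Lemma ladd_mono r s t u : t <= n -> u <= n -> r <= t -> s <= u ->
  ladd r s <= ladd t u.
Proof.
move=> tn un rt su; apply: lnext_le; [lia|lia| |].
  by apply: rank_mono; lia.
by apply: rank_le_top; lia.
Qed.

Lemma laddr0 r : r <= n -> ladd r 0 = r.
Proof.
by move=> rn; rewrite laddC laddE //; apply/eqP; rewrite lnext_id.
Qed.

Lemma ladd_fixed r s : r <= s -> s <= n -> (ladd r s == s) = (rank a r <= a s).
Proof.
by move=> rs sn; rewrite laddE // lnext_id // rank_le_top // (leq_trans rs).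
Qed.

(** The points passed over have level below [j], hence below the rank already reached, and do not
    raise it. *)
Lemma rank_next s j : s <= n -> j <= rank a s -> rank a (lnext s j) = rank a s.
Proof.
move=> sn jr; have jn : j <= a n by apply: leq_trans jr _; exact: rank_le_top.
have [h1 h2 h3 h4] := lnext_spec sn jn.
suff H t : s <= t <= lnext s j -> rank a t = rank a s by apply: H; lia.
elim: t => [|t IH] ht; first by congr rank; lia.
have [->//|st] := eqVneq s t.+1.
by rewrite /= IH; [have := h4 t|]; lia.
Qed.

(* For [r <= s <= t] every bracketing collapses to [s + t], which gives
   associativity and Archimedean complexity at most 2 at once. *)
Lemma ladd_absorb r s t : r <= s -> s <= t -> t <= n ->
  [/\ ladd t (ladd r s) = ladd s t, ladd s (ladd r t) = ladd s t
    & ladd r (ladd s t) = ladd s t].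
Proof.
move=> rs st tn; have sn := leq_trans st tn; have rn := leq_trans rs sn.
have rsk := rank_mono a rs; have stk := rank_mono a st.
have rk := rank_le_top rn; have sk := rank_le_top sn; have tk := rank_le_top tn.
have [t1 t2 _ _] := lnext_spec tn rk.
have [u1 u2 _ _] := lnext_spec tn sk.
have [v1 v2 _ _] := lnext_spec sn rk.
split.
- rewrite (laddE rs) (laddE st); have E := rank_next sn rsk.
  have [le|lt] := leqP (lnext s (rank a r)) t; first by rewrite laddC laddE // E.
  (* Here [t] lies between [s] and [r + s], which have the same rank. *)
  have Et : rank a t = rank a s.
    by have := rank_mono a (ltnW lt); rewrite E; lia.
  rewrite laddE ?(ltnW lt) // Et lnext_next_le //.
  apply/esym/lnext_gap => //; rewrite st /=.
  by apply: (leq_trans (ltnW lt)); apply: lnext_le.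
- rewrite (laddE (leq_trans rs st)) laddE ?(leq_trans st) //.
  by rewrite (laddE st) lnext_next_le.
- rewrite (laddE st) laddE ?(leq_trans _ u1) ?(leq_trans rs) //.
  exact: lnext_next_ge.
Qed.

Lemma laddA r s t : r <= n -> s <= n -> t <= n ->
  ladd r (ladd s t) = ladd (ladd r s) t.
Proof.
move=> rn sn tn; rewrite [RHS]laddC.
have [rs|/ltnW rs] := leqP r s; have [st|/ltnW st] := leqP s t;
  have [rt|/ltnW rt] := leqP r t.
- by have [A B C] := ladd_absorb rs st tn; rewrite C A.
(* A cyclic chain of comparisons makes the three elements equal. *)
- have -> : r = s by lia.
  by have -> : t = s by lia.
- by have [A B C] := ladd_absorb rt st sn; rewrite (laddC s t) C B.
- by have [A B C] := ladd_absorb rt rs sn; rewrite (laddC s t) B C.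
- by have [A B C] := ladd_absorb rs rt tn; rewrite B (laddC r s) A.
- by have [A B C] := ladd_absorb st rt rn; rewrite A (laddC r s) B.
- have -> : r = s by lia.
  by have -> : t = s by lia.
- by have [A B C] := ladd_absorb st rs rn; rewrite (laddC s t) A (laddC r s) C.
Qed.

End LevelAddition.

(* The values of [rank] on [0 .. x] fill [0 .. rank x], so [a x] is determined
   by the set of [r <= x] with [r + x = x]. *)
Lemma ladd_inj n a a' :
  (forall x, x <= n -> a x <= rank a x) -> a n = rank a n ->
  (forall x, x <= n -> a' x <= rank a' x) -> a' n = rank a' n ->
  (forall r s, r <= s -> s <= n -> ladd n a r s = ladd n a' r s) ->
  forall x, x <= n -> a x = a' x.
Proof.
move=> H T H' T' E; elim/ltn_ind=> x IH xn.
have R r : r <= x -> rank a r = rank a' r.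
  by move=> rx; apply: eq_rank => y yr; apply: IH; lia.
have F r : r <= x -> (rank a r <= a x) = (rank a r <= a' x).
  by move=> rx; rewrite -(ladd_fixed T) // E // ladd_fixed // R.
(* The ranks of [r] and [r'] are the two levels at [x]; testing each against the other addition
   compares these levels both ways. *)
have [r rx Er] := rank_surj H xn (H _ xn).
have [r' rx' Er'] := rank_surj H' xn (H' _ xn).
have := F r rx; have := F r' rx'; rewrite (R r') // Er Er' !leqnn.
by move=> h1 h2; apply/eqP; rewrite eqn_leq h1 -h2.
Qed.

(** * Reduction to the standard chain *)

Definition absorbing (R : ordAddStruct) : Prop :=
  forall r s t : R, ole r s -> ole s t -> oadd r (oadd s t) = oadd s t.

Definition max_like (R : ordAddStruct) : Prop :=
  forall r s : R, ole r s -> oadd r s = s.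

Lemma arch_cond2P (R : ordAddStruct) : distance_monoid R ->
  arch_cond R 2 <-> absorbing R.
Proof.
move=> D; split=> [H r s t rs st|H r h].
  have := H (fun i => if i is i'.+1 then if i' is _.+1 then t else s else r).
  rewrite /index_iota /= !big_cons !big_nil /= !(dm_addr0 D) => -> //.
  by move=> [|[|]].
by rewrite /index_iota /= !big_cons !big_nil /= !(dm_addr0 D) H //; apply: h.
Qed.

Lemma arch_cond1P (R : ordAddStruct) : distance_monoid R ->
  arch_cond R 1 <-> max_like R.
Proof.
move=> D; split=> [H r s rs|H r h].
  have := H (fun i => if i is i'.+1 then s else r).
  by rewrite /index_iota /= !big_cons !big_nil /= !(dm_addr0 D) => -> // -[].
by rewrite /index_iota /= !big_cons !big_nil /= !(dm_addr0 D) H //; apply: h.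
Qed.

(** Complexity 0 makes every element zero. Thus the single condition [~ max_like R] excludes both 0
    and 1. *)
Lemma arch_cond0_max (R : ordAddStruct) : distance_monoid R ->
  arch_cond R 0 -> max_like R.
Proof.
move=> D H; have all0 (x : R) : x = ozero R.
  by have := H (fun=> x); rewrite /index_iota /= !big_cons !big_nil /= !(dm_addr0 D) => ->.
by move=> r s _; rewrite (all0 (oadd _ _)).
Qed.

Lemma arch2P (R : ordAddStruct) : distance_monoid R ->
  arch R = Some 2 <-> absorbing R /\ ~ max_like R.
Proof.
move=> D; rewrite /arch; case: pselect => [exm|nexm]; last first.
  split=> // -[/(arch_cond2P D) H _]; case: nexm; exists 2; exact/asboolP.
case: ex_minnP => m /asboolP Hm min; split=> [[Em]|[A nM]].
  split; first by apply/(arch_cond2P D); rewrite -Em.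
  move=> /(arch_cond1P D) H1.
  by have := min 1 (introT (asboolP _) H1); rewrite Em.
congr Some; have := min 2 (introT (asboolP _) (proj2 (arch_cond2P D) A)).
case: m Hm {min} => [|[|[|//]]] Hm _ //.
  by case: nM; exact: arch_cond0_max.
by case: nM; apply/(arch_cond1P D).
Qed.

Definition arch_two (R : ordAddStruct) : Prop :=
  [/\ distance_monoid R, absorbing R & ~ max_like R].

Lemma iso_refl R : isomorphic R R.
Proof. by exists id; split=> //; exists id. Qed.

Lemma iso_sym R S : isomorphic R S -> isomorphic S R.
Proof.
case=> phi [[psi K K'] z m o]; exists psi; split.
- by exists phi.
- by rewrite -z K.
- by move=> r s; apply: (can_inj K); rewrite m !K'.
- by move=> r s; rewrite -o !K'.
Qed.

Lemma iso_trans R S T : isomorphic R S -> isomorphic S T -> isomorphic R T.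
Proof.
case=> f [fb fz fm fo] [g [gb gz gm go]]; exists (g \o f); split.
- exact: bij_comp.
- by rewrite /= fz.
- by move=> r s; rewrite /= fm gm.
- by move=> r s; rewrite /= go fo.
Qed.

Lemma iso_arch_two R S : isomorphic R S -> arch_two R -> arch_two S.
Proof.
move/iso_sym=> [f [[g K K'] z m o]] [[l1 l2 l3 l4 l5 l6 l7 l8 l9] A M].
have inj := can_inj K; split.
- split.
  + by move=> r; rewrite -o.
  + by move=> r s; rewrite -!o => /l2/inj.
  + by move=> r s t; rewrite -!o; exact: l3.
  + by move=> r s; rewrite -!o.
  + by move=> r s; rewrite -o m.
  + by move=> r s t u; rewrite -!o !m; exact: l6.
  + by move=> r s; apply: inj; rewrite !m l7.
  + by move=> r s t; apply: inj; rewrite !m l8.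
  + by move=> r; apply: inj; rewrite m z l9.
- by move=> r s t; rewrite -!o => *; apply: inj; rewrite !m A.
- by move=> H; apply: M => r s rs; rewrite -(K' r) -(K' s) -m H // -o !K'.
Qed.

Definition std_le (n : nat) : {ffun 'I_n.+1 * 'I_n.+1 -> bool} :=
  [ffun p : 'I_n.+1 * 'I_n.+1 => p.1 <= p.2].

(** Each element is sent to the number of its strict predecessors. *)
Lemma chain_rank (n : nat) (R : rel 'I_n.+1) :
  reflexive R -> antisymmetric R -> transitive R -> total R ->
  exists2 f : 'I_n.+1 -> 'I_n.+1, bijective f & forall r s, (f r <= f s) = R r s.
Proof.
move=> refl anti trans tot.
pose D r := [set t | R t r & t != r].
have Dn r : #|D r| < n.+1.
  rewrite -[X in _ < X]card_ord -cardsT; apply: proper_card.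
  by apply/properP; split; [exact: subsetT | exists r; rewrite !inE ?eqxx ?andbF].
have mono r s : (#|D r| <= #|D s|) = R r s.
  have lt x y : R x y -> x != y -> #|D x| < #|D y|.
    move=> xy nxy; apply: proper_card; apply/properP; split; last first.
      by exists x; rewrite !inE ?xy ?nxy // eqxx andbF.
    apply/subsetP=> t; rewrite !inE => /andP[tx ntx].
    rewrite (trans _ _ _ tx xy) /=; apply: contraNneq nxy => ty.
    by apply/eqP/anti; rewrite xy -ty.
  have [->|nrs] := eqVneq r s; first by rewrite refl leqnn.
  have [rs|sr] := orP (tot r s); first by rewrite rs (ltnW (lt _ _ rs nrs)).
  rewrite leqNgt lt 1?eq_sym //=; apply/esym/negbTE.
  by apply: contraNN nrs => rs; apply/eqP/anti; rewrite rs.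
have monof r s : (Ordinal (Dn r) <= Ordinal (Dn s)) = R r s by exact: mono.
exists (fun r => Ordinal (Dn r)) => //; apply: injF_bij => r s E.
by apply: anti; rewrite -!mono; move/(congr1 val): E => /= ->; rewrite leqnn.
Qed.

Lemma iso_std (n : nat) (x : structOn 'I_n.+1) :
  distance_monoid (structOf x) ->
  exists2 y : structOn 'I_n.+1, y.1.2 = std_le n & isomorphic (structOf x) (structOf y).
Proof.
case: x => [[add le] z] [/= l1 l2 l3 l4 _ _ _ _ _].
have [f fb fm] := chain_rank l1 l2 l3 l4; have [g K K'] := fb.
exists ([ffun p : 'I_n.+1 * 'I_n.+1 => f (add (g p.1, g p.2))], std_le n, f z) => //.
exists f; split=> // r s /=; first by rewrite ffunE /= !K.
by rewrite ffunE /= fm.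
Qed.

(** By induction: each step up in the argument moves the value strictly up. *)
Lemma leq_mono_ord (n : nat) (f : 'I_n -> 'I_n) :
  (forall r s, (f r <= f s) = (r <= s)) -> forall x : 'I_n, x <= f x.
Proof.
move=> mono [x xn]; elim: x xn => [//|x IH] xn.
apply: leq_ltn_trans (IH (ltnW xn)) _.
by rewrite ltnNge mono /= ltnn.
Qed.

(** Neither the isomorphism nor its inverse lowers an element, so it is the identity. *)
Lemma std_rigid (n : nat) (x y : structOn 'I_n.+1) :
  x.1.2 = std_le n -> y.1.2 = std_le n ->
  isomorphic (structOf x) (structOf y) -> x = y.
Proof.
case: x => [[add le] z]; case: y => [[add' le'] z'] /= -> -> [f [[g K K'] fz fm fo]].
have mono r s : (f r <= f s) = (r <= s) by have := fo r s; rewrite /= !ffunE.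
have gmono r s : (g r <= g s) = (r <= s) by rewrite -mono !K'.
have fid r : f r = r.
  apply/val_inj/eqP; rewrite eqn_leq (leq_mono_ord mono) andbT.
  by rewrite -{2}(K r) (leq_mono_ord gmono).
have <- : z = z' by rewrite -(fid z); exact: fz.
congr (_, _, _); apply/ffunP=> -[r s].
by have /= := fm r s; rewrite !fid.
Qed.

Definition arch_two_std (n : nat) : {set structOn 'I_n.+1} :=
  [set x | (x.1.2 == std_le n) && `[< arch_two (structOf x) >]].

(** Each class has a representative with the standard order by [iso_std], and only one by
    [std_rigid]. *)
Lemma DM2_std (n : nat) : DM n 2 = #|arch_two_std n|.
Proof.
rewrite /DM; set E := fun x y => _; set A := [set x | _].
have AE x : (x \in A) = `[< arch_two (structOf x) >].
  rewrite inE; apply/asboolP/asboolP => [[D /(arch2P D)[]]|[D ? ?]] //.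
  by split=> //; apply/arch2P.
have sub x : x \in arch_two_std n -> x \in A by rewrite AE inE => /andP[].
pose cls x := [set y in A | E x y].
have clsE x y : E x y -> cls x = cls y.
  move/asboolP=> xy; apply/setP=> t; rewrite !inE; congr andb.
  apply/asboolP/asboolP; first exact/iso_trans/iso_sym.
  exact: iso_trans.
have -> : equivalence_partition E A = [set cls x | x in arch_two_std n].
  apply/setP=> B; apply/imsetP/imsetP => -[x xA ->]; last first.
    by exists x => //; exact: sub.
  move: xA; rewrite AE => /asboolP T; have [D _ _] := T.
  have [y ystd xy] := iso_std D.
  exists y; last by apply: clsE; apply/asboolP.
  by rewrite inE ystd eqxx; apply/asboolP; exact: iso_arch_two T.
apply: card_in_imset => x y xA yA Exy.
have : y \in cls x by rewrite Exy inE sub //=; apply/asboolP/iso_refl.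
rewrite inE => /andP[_ /asboolP iso].
move: xA yA; rewrite !inE => /andP[/eqP xs _] /andP[/eqP ys _].
exact: std_rigid.
Qed.

(** * Levels of an absorbing monoid *)

Lemma eq_ladd n a a' r s : (forall x, x <= n -> a x = a' x) ->
  r <= n -> s <= n -> ladd n a r s = ladd n a' r s.
Proof.
move=> E rn sn; rewrite /ladd /lnext; congr (_ + _).
have -> : rank a (minn r s) = rank a' (minn r s).
  by apply: eq_rank => y ?; apply: E; lia.
apply: eq_in_find => y; rewrite mem_iota => ?; rewrite E //; lia.
Qed.

(** Through this identity, [a x <= rank a x] is the restricted growth condition. *)
Lemma rk_mkseq a x : rk 0 (mkseq a x) = rank a x.
Proof.
elim: x => // x IH; rewrite /mkseq -[x.+1]addn1 iotaD map_cat /rk foldl_cat.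
by rewrite -/(mkseq a x) -/(rk 0 _) IH addn1.
Qed.

Lemma take_mkseq (T : Type) (a : nat -> T) i n : i <= n -> take i (mkseq a n) = mkseq a i.
Proof. by move=> le; rewrite /mkseq -map_take take_iota (minn_idPl le). Qed.

(* The default of [nth] supplies the forced level of the greatest element. *)
Definition lev (s : seq nat) (x : nat) : nat := nth (rk 0 s) s x.

Lemma rank_lev s x : x <= size s -> rank (lev s) x = rk 0 (take x s).
Proof.
by move=> le; rewrite -rk_mkseq -(take_mkseq _ le) /lev mkseq_nth.
Qed.

Lemma lev_top s : lev s (size s) = rank (lev s) (size s).
Proof. by rewrite rank_lev // take_size /lev nth_default. Qed.

Lemma lev_le n s : s \in rgs n 0 -> forall x, x <= n -> lev s x <= rank (lev s) x.
Proof.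
case/mem_rgs=> sz H x; rewrite leq_eqVlt => /predU1P[->|lt].
  by rewrite -sz lev_top.
have xn := ltnW lt.
by rewrite rank_lev ?sz // /lev (set_nth_default 0) ?sz // H.
Qed.

(** For [s] in [rgs n 0] the cast [inord] changes no value, by [ladd_bound]. *)
Definition lev_struct (n : nat) (s : seq nat) : structOn 'I_n.+1 :=
  ([ffun p : 'I_n.+1 * 'I_n.+1 => inord (ladd n (lev s) p.1 p.2)], std_le n, ord0).

Lemma lev_struct_inj n : {in rgs n 0 &, injective (lev_struct n)}.
Proof.
move=> s s' Hs Hs' E.
have [sz _] := mem_rgs _ _ _ Hs; have [sz' _] := mem_rgs _ _ _ Hs'.
have T : lev s n = rank (lev s) n by rewrite -sz lev_top.
have T' : lev s' n = rank (lev s') n by rewrite -sz' lev_top.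
have L : forall x, x <= n -> lev s x = lev s' x.
  apply: (ladd_inj (lev_le Hs) T (lev_le Hs') T') => r u ru un.
  have rn := leq_trans ru un.
  case: E => /ffunP /(_ (Ordinal (rn : r < n.+1), Ordinal (un : u < n.+1))).
  rewrite !ffunE /= => /(congr1 (@nat_of_ord _)); rewrite !inordK // ltnS; exact: ladd_bound.
apply: (@eq_from_nth _ 0) => [|i]; rewrite sz ?sz' // => lt.
have := L i (ltnW lt); rewrite /lev (set_nth_default 0) ?sz // => ->.
by rewrite (set_nth_default 0) ?sz'.
Qed.

Lemma lev_struct_dm n s : s \in rgs n 0 ->
  distance_monoid (structOf (lev_struct n s)) /\
  absorbing (structOf (lev_struct n s)).
Proof.
move=> Hs; have [sz _] := mem_rgs _ _ _ Hs.
have T : lev s n = rank (lev s) n by rewrite -sz lev_top.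
set R := structOf _.
have le (x : 'I_n.+1) : x <= n by rewrite -ltnS.
have addE (x y : R) : oadd x y = ladd n (lev s) x y :> nat.
  by rewrite /= ffunE inordK // ltnS; exact: ladd_bound.
have leE (x y : 'I_n.+1) : @ole R x y = (x <= y) by rewrite /= ffunE.
split; last first.
  move=> r u t; rewrite !leE => ru ut; apply: val_inj; rewrite /= !addE.
  by have [] := ladd_absorb T ru ut (le t).
split.
- by move=> x; rewrite leE.
- by move=> x y; rewrite !leE => h; apply/val_inj/eqP; rewrite eqn_leq.
- by move=> x y z; rewrite !leE; exact: leq_trans.
- by move=> x y; rewrite !leE leq_total.
- by move=> x y; rewrite leE addE; exact: leq_laddr.
- by move=> x y z u; rewrite !leE !addE; exact: ladd_mono.
- by move=> x y; apply: val_inj; rewrite /= !addE laddC.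
- by move=> x y z; apply: val_inj; rewrite /= !addE laddA.
- by move=> x; apply: val_inj; rewrite /= addE laddr0.
Qed.

(** * Recovering the levels from the addition *)

Section MonoidLevels.

Variables (n : nat) (op : 'I_n.+1 -> 'I_n.+1 -> 'I_n.+1).
Hypothesis opC : commutative op.
Hypothesis opA : associative op.
Hypothesis op0 : right_id ord0 op.
Hypothesis op_ge : forall r s : 'I_n.+1, r <= op r s.
Hypothesis op_mono : forall r s t u : 'I_n.+1, r <= t -> s <= u -> op r s <= op t u.
Hypothesis op_abs : forall r s t : 'I_n.+1, r <= s -> s <= t -> op r (op s t) = op s t.

(** The argument is a natural number so that it may be [n.+1], one past the greatest element. *)
Definition idems_below (x : nat) : {set 'I_n.+1} :=
  [set e : 'I_n.+1 | (e < x) && (op e e == e)].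

Definition idems_fixing (y : 'I_n.+1) : {set 'I_n.+1} :=
  [set e : 'I_n.+1 | [&& e <= y, op e e == e & op e y == y]].

(* [ord0] always fixes [y]; it is not counted. *)
Definition op_level (x : nat) : nat := #|idems_fixing (inord x)|.-1.

Lemma op_levelK (y : 'I_n.+1) : (op_level y).+1 = #|idems_fixing y|.
Proof.
rewrite /op_level inord_val prednK //; apply/card_gt0P; exists ord0.
by rewrite inE /= opC !op0 !eqxx.
Qed.

Lemma card_idems_belowS (x : 'I_n.+1) :
  #|idems_below x.+1| = #|idems_below x| + (op x x == x).
Proof.
rewrite (cardsD1 x) addnC inE ltnSn /=; congr (#|pred_of_set _| + _).
apply/setP=> e; rewrite !inE ltnS [in RHS]ltn_neqAle andbA.
by rewrite (inj_eq val_inj).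
Qed.

Lemma idems_fixing_sub (y : 'I_n.+1) : idems_fixing y \subset idems_below y.+1.
Proof. by apply/subsetP=> e; rewrite !inE ltnS => /and3P[-> ->]. Qed.

(** An idempotent [e <= y] fixes an idempotent [y], because [y <= e + y <= y + y = y]. Counting [y]
    itself makes up for leaving out zero. *)
Lemma op_level_idem (y : 'I_n.+1) : op y y = y -> op_level y = #|idems_below y|.
Proof.
move=> yy; apply: succn_inj; rewrite op_levelK -[RHS]addn1.
have := card_idems_belowS y; rewrite yy eqxx => <-.
congr #|pred_of_set _|; apply/eqP; rewrite eqEsubset idems_fixing_sub /=.
apply/subsetP=> e; rewrite !inE ltnS => /andP[ey ->]; rewrite ey /=.
apply/eqP/val_inj/eqP; rewrite eqn_leq [in X in _ && X]opC op_ge andbT.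
by rewrite -[X in _ <= val X]yy op_mono.
Qed.

Lemma op_level_le (y : 'I_n.+1) : op_level y <= #|idems_below y|.
Proof.
rewrite -ltnS op_levelK; apply: (leq_trans (subset_leq_card (idems_fixing_sub y))).
by rewrite card_idems_belowS; case: eqP; lia.
Qed.

(** Passing an idempotent raises both sides by one, as its level attains the rank. At any other
    element the level is strictly smaller and neither side changes. *)
Lemma rank_op_level x : x <= n -> rank op_level x = #|idems_below x|.
Proof.
elim: x => [|x IH] xn /=.
  by apply/esym/eqP; rewrite cards_eq0; apply/eqP/setP=> e; rewrite !inE ltn0.
pose y : 'I_n.+1 := Ordinal (leqW xn : x < n.+1).
rewrite IH ?(ltnW xn) // -[x]/(val y) card_idems_belowS.
case: eqP => [/op_level_idem -> | ne]; first by rewrite addn1; apply/maxn_idPr.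
rewrite addn0; apply/maxn_idPl; rewrite op_levelK.
apply: leq_trans (subset_leq_card (idems_fixing_sub y)) _.
by rewrite card_idems_belowS; move/eqP/negbTE: ne => ->; rewrite addn0.
Qed.

Lemma op_level_top : op_level n = rank op_level n.
Proof.
rewrite rank_op_level // -[n]/(val (@ord_max n)); apply: op_level_idem.
by apply/val_inj/eqP; rewrite eqn_leq op_ge -ltnS ltn_ord.
Qed.

(** If the level is this large, some idempotent [e >= r] fixes [y], and [y <= r + y <= e + y = y].
    Conversely, if [r] fixes [y], then so do all idempotents below [r] and also the idempotent
    [r + r], which is not below [r]. *)
Lemma op_fixed (r y : 'I_n.+1) : r <= y ->
  (#|idems_below r| <= op_level y) = (op r y == y).
Proof.
move=> ry; rewrite -ltnS op_levelK; apply/idP/eqP => [lt|fix_y].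
  have [e eF re] : exists2 e, e \in idems_fixing y & r <= e.
    apply/exists_inP; apply: contraTT lt => /exists_inPn H.
    rewrite -leqNgt; apply/subset_leq_card/subsetP => e eF.
    have := H e eF; rewrite -ltnNge => er.
    by move: eF; rewrite !inE er => /and3P[].
  move: eF; rewrite inE => /and3P[_ _ /eqP ey].
  apply/val_inj/eqP; rewrite eqn_leq [in X in _ && X]opC op_ge andbT.
  by rewrite -[X in _ <= val X]ey op_mono.
have rr : op r (op r r) = op r r by exact: op_abs.
have E : op (op r r) y = y by rewrite -opA !fix_y.
have rn : op r r \notin idems_below r by rewrite inE ltnNge op_ge.
have -> : #|idems_below r|.+1 = #|op r r |: idems_below r| by rewrite cardsU1 rn.
apply/subset_leq_card/subsetP => e; rewrite !inE => /orP[/eqP->|/andP[er ->]].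
  by rewrite -{1}E op_ge -opA !rr E !eqxx.
rewrite (leq_trans (ltnW er)) //=; apply/eqP/val_inj/eqP.
rewrite eqn_leq [in X in _ && X]opC op_ge andbT.
by rewrite -[X in _ <= val X]fix_y op_mono // ltnW.
Qed.

(** For [r <= s], the sum is the least [y >= s] fixed by [r]: absorption shows that it is fixed, and
    a fixed [y >= s] satisfies [r + s <= r + y = y]. By [op_fixed] this is the search made by
    [lnext]. *)
Lemma op_ladd (r s : 'I_n.+1) : op r s = ladd n op_level r s :> nat.
Proof.
wlog rs : r s / r <= s => [H|].
  by have [/H//|/ltnW/H] := leqP r s; rewrite opC laddC.
have [rn sn] : r <= n /\ s <= n by split; rewrite -ltnS.
rewrite laddE // rank_op_level //; apply/esym.
have rsE : op r (op r s) = op r s by exact: op_abs.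
have s_le : s <= op r s by rewrite opC op_ge.
apply: lnext_eq => //.
- by rewrite -ltnS.
- by rewrite op_fixed ?(leq_trans rs) // rsE.
- by rewrite op_level_top rank_op_level //; apply/subset_leq_card/subsetP => e;
    rewrite !inE => /andP[er ->]; rewrite andbT (leq_trans er).
move=> y /andP[sy ylt].
have yn : y < n.+1 by apply: ltn_trans ylt _.
rewrite ltnNge -[y]/(val (Ordinal yn)) op_fixed /=; last exact: leq_trans sy.
apply/eqP=> E; have : op r s <= op r (Ordinal yn) by exact: op_mono.
by rewrite E leqNgt ylt.
Qed.

End MonoidLevels.

(** * Counting the absorbing monoids on the standard chain *)

Definition absorbing_std (n : nat) : {set structOn 'I_n.+1} :=
  [set x | (x.1.2 == std_le n) &&
     `[< distance_monoid (structOf x) /\ absorbing (structOf x) >]].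

Lemma std_zero n (x : structOn 'I_n.+1) :
  x.1.2 = std_le n -> distance_monoid (structOf x) -> x.2 = ord0.
Proof.
case: x => [[add le] z] /= -> D; apply/val_inj/eqP; rewrite /= -leqn0.
have := dm_le_addr D z ord0; rewrite (dm_addC D) (dm_addr0 D) /= ffunE; exact.
Qed.

Lemma absorbing_std_lev n x :
  x \in absorbing_std n -> exists2 s, s \in rgs n 0 & x = lev_struct n s.
Proof.
rewrite inE => /andP[/eqP xs /asboolP[D A]].
have z0 := std_zero xs D; case: x xs D A z0 => [[add le] z] /= -> D A z0.
subst z; pose op r s := add (r, s).
have opC : commutative op by exact: (dm_addC D).
have opA : associative op by exact: (dm_addA D).
have op0 : right_id ord0 op by exact: (dm_addr0 D).
have op_ge (r s : 'I_n.+1) : r <= op r s by have := dm_le_addr D r s; rewrite /= ffunE.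
have op_mono (r s t u : 'I_n.+1) : r <= t -> s <= u -> op r s <= op t u.
  by have := @dm_le_add _ D r s t u; rewrite /= !ffunE.
have op_abs (r s t : 'I_n.+1) : r <= s -> s <= t -> op r (op s t) = op s t.
  by have := A r s t; rewrite /= !ffunE.
(* Only the levels below [n] are recorded; the level of the greatest element is forced and is
   restored by the default in [lev]. *)
pose a := op_level op; pose s := mkseq a n.
have rkE i : i <= n -> rk 0 (take i s) = rank a i.
  by move=> lei; rewrite take_mkseq // rk_mkseq.
exists s.
  apply/mem_rgs; split=> [|i lti]; first by rewrite size_mkseq.
  have lei := ltnW lti; rewrite nth_mkseq // rkE // rank_op_level //.
  by rewrite -[i]/(val (Ordinal (ltnW lti : i < n.+1))) op_level_le.
have levE x : x <= n -> lev s x = a x.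
  rewrite /lev leq_eqVlt => /predU1P[->|lt]; last by rewrite nth_mkseq.
  rewrite nth_default ?size_mkseq // rk_mkseq /a op_level_top //.
congr (_, _, _); apply/ffunP=> -[r t]; rewrite ffunE /=; apply: val_inj => /=.
have [rn tn] : r <= n /\ t <= n by split; rewrite -ltnS.
rewrite (eq_ladd levE) // -(op_ladd opC opA op0 op_ge op_mono op_abs).
by rewrite inord_val.
Qed.

Lemma card_absorbing_std n : #|absorbing_std n| = size (rgs n 0).
Proof.
have U : uniq [seq lev_struct n s | s <- rgs n 0].
  by rewrite map_inj_in_uniq ?rgs_uniq //; exact: lev_struct_inj.
rewrite -(size_map (lev_struct n)) -(card_uniqP U); apply: eq_card => x.
apply/idP/mapP => [/absorbing_std_lev[s]|[s Hs ->]]; first by exists s.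
rewrite inE eqxx; apply/asboolP; exact: lev_struct_dm.
Qed.

Definition max_struct (n : nat) : structOn 'I_n.+1 :=
  ([ffun p : 'I_n.+1 * 'I_n.+1 => if p.1 <= p.2 then p.2 else p.1], std_le n, ord0).

Lemma max_structP n (x : structOn 'I_n.+1) :
  x.1.2 = std_le n -> distance_monoid (structOf x) ->
  max_like (structOf x) <-> x = max_struct n.
Proof.
move=> xs D; have z0 := std_zero xs D.
case: x xs D z0 => [[add le] z] /= -> D ->; split=> [M|[->] r s].
  congr (_, _, _); apply/ffunP=> -[r s]; rewrite ffunE /=.
  case: leqP => [rs|/ltnW sr]; first by apply: M; rewrite /= ffunE.
  rewrite (_ : add (r, s) = add (s, r)); last exact: (dm_addC D).
  by apply: M; rewrite /= ffunE.
by rewrite /= !ffunE /= => ->.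
Qed.

Lemma max_struct_absorbing n : max_struct n \in absorbing_std n.
Proof.
rewrite inE eqxx; apply/asboolP; set R := structOf _.
have addE (x y : R) : oadd x y = maxn x y :> nat.
  by rewrite /= ffunE /=; case: leqP => h; lia.
have leE (x y : 'I_n.+1) : @ole R x y = (x <= y) by rewrite /= ffunE.
split; last first.
  move=> r u t; rewrite !leE => ru ut; apply: val_inj; rewrite /= !addE; lia.
split.
- by move=> x; rewrite leE.
- by move=> x y; rewrite !leE => h; apply/val_inj/eqP; rewrite eqn_leq.
- by move=> x y z; rewrite !leE; exact: leq_trans.
- by move=> x y; rewrite !leE leq_total.
- by move=> x y; rewrite leE addE; lia.
- by move=> x y z u; rewrite !leE !addE; lia.
- by move=> x y; apply: val_inj; rewrite /= !addE maxnC.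
- by move=> x y z; apply: val_inj; rewrite /= !addE maxnA.
- by move=> x; apply: val_inj; rewrite /= addE maxn0.
Qed.

(** Absorbing means complexity at most 2, and [max_struct n] is the only structure among these of
    complexity at most 1; it accounts for the successor. *)
Lemma DM2_rgs n : (DM n 2).+1 = size (rgs n 0).
Proof.
rewrite DM2_std -card_absorbing_std.
rewrite [RHS](cardsD1 (max_struct n)) max_struct_absorbing.
rewrite add1n; congr (#|pred_of_set _|.+1); apply/setP=> x; rewrite !inE.
rewrite andbCA; case: eqP => //= xs; apply/asboolP/andP => [[D A M]|].
  split; last by apply/asboolP.
  by apply/eqP=> /(max_structP xs D).
by case=> /eqP nm /asboolP[D A]; split=> // /(max_structP xs D).
Qed.

Theorem theorem1p1 (n : nat) (hn : 2 <= n) :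
  DM n 2 =
  \sum_(1 <= k < n) \sum_(f in compositions n k)
     \prod_(j < k) j.+1 ^ (f j - 1).
Proof.
by apply: succn_inj; rewrite DM2_rgs sum_compositions // ltnW.
Qed.
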